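(* (Relations between $S$ and $\Xi$.) For any composition $I$, in $\mathcal NSym$ we have $$S^I=\sum_{J\succeq I}\frac{1}{\pi_u(\bar J,\bar I)}\,\Xi^J,\qquad \Xi^I=(-1)^{\ell(I)}\sum_{J\succeq I}(-1)^{\ell(J)}\,fp(J,I)\,S^J,$$ where $J$ ranges over compositions.
   Context: $K$ is a unital commutative $\mathbb Q$-algebra and $t$ a central formal parameter. $\mathcal NSym$ is the free unital associative $K$-algebra on noncommuting variables $\Lambda_m$ ($m\ge1$), $\Lambda_0=1$, $\lambda(t)=\sum_{m\ge0}t^m\Lambda_m$. Elements $S_m,\Xi_m$ of $\mathcal NSym$ are defined by $\sigma(t)=\sum_{m\ge0}t^mS_m$, $\xi(t)=\sum_{m\ge1}t^{m-1}\Xi_m$, the unique solutions in $\mathcal NSym[[t]]$ of $\lambda(-t)\sigma(t)=\sigma(t)\lambda(-t)=1$, $\frac{d\sigma(t)}{dt}=\xi(t)\sigma(t)$. A composition is a nonempty finite sequence $I=(i_1,\dots,i_m)$ of positive integers; $\ell(I)=m$, $|I|=\sum i_j$, $\bar I=(i_m,\dots,i_1)$. For a sequence $w=\{w_k\}$, $w^I=w_{i_1}\cdots w_{i_m}$. $fp(I)=i_1$, $\pi_u(I)=\prod_{j=1}^m(i_1+\cdots+i_j)$. $J\succeq I$ means $J$ is a refinement of $I$: $J$ is the concatenation $J_1\cdot J_2\cdots J_m$ of compositions $J_a$ with $|J_a|=i_a$; then $\pi_u(J,I)=\prod_a\pi_u(J_a)$, $fp(J,I)=\prod_afp(J_a)$.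 *)

(* Defs.v *)
From HB Require Import structures.
From mathcomp Require Import all_boot all_order ssralg ssrnum ssrint rat poly.
From mathcomp.multinomials Require Import monalg.

Set Implicit Arguments.
Unset Strict Implicit.
Unset Printing Implicit Defensive.

Import GRing.Theory.
Local Open Scope ring_scope.

(* The letter [j : nat] of the free monoid stands for the variable Lambda_(j+1):
   the generators are indexed by the positive integers. *)
Notation NSym K := {malg K[{fmonom nat}]}.

Definition Lambda (K : comNzRingType) (m : nat) : NSym K :=
  if m is j.+1 then << fmu j >> else 1.

(* A power series in a central variable t is its sequence of coefficients. *)
Section PowerSeries.
Variable A : nzRingType.
Implicit Types f g h : nat -> A.

Definition ps_one : nat -> A := fun n => (n == 0%N)%:R.
Definition ps_mul f g : nat -> A := fun n => \sum_(i < n.+1) f i * g (n - i)%N.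
(* f(-t) *)
Definition ps_alt f : nat -> A := fun n => (-1) ^+ n * f n.
Definition ps_deriv f : nat -> A := fun n => f n.+1 *+ n.+1.
(* \sum_(m >= 1) t^(m-1) w_m; the value w_0 plays no role. *)
Definition ps_shift (w : nat -> A) : nat -> A := fun n => w n.+1.

Let pol n f : {poly A} := \poly_(i < n.+1) f i.

Lemma ps_mulE n f g i : (i <= n)%N -> ps_mul f g i = (pol n f * pol n g)`_i.
Proof.
move=> le_in; rewrite coefM; apply: eq_bigr => -[j lt_ji] _ /=.
by rewrite !coef_poly !ltnS (leq_trans _ le_in) // (leq_trans (leq_subr _ _) le_in).
Qed.

Lemma eq_ps_mul f f' g g' : f =1 f' -> g =1 g' -> ps_mul f g =1 ps_mul f' g'.
Proof. by move=> ef eg n; apply: eq_bigr => i _; rewrite ef eg. Qed.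

Lemma ps_mulA f g h : ps_mul f (ps_mul g h) =1 ps_mul (ps_mul f g) h.
Proof.
move=> n; rewrite (ps_mulE _ _ (leqnn n)) (ps_mulE (ps_mul f g) _ (leqnn n)).
transitivity ((pol n f * (pol n g * pol n h))`_n).
  rewrite !coefM; apply: eq_bigr => -[j lt_j] _ /=; congr (_ * _).
  rewrite coef_poly ltnS leq_subr; exact/ps_mulE/leq_subr.
rewrite mulrA [in LHS]coefM [in RHS]coefM; apply: eq_bigr => -[j lt_j] _ /=.
by congr (_ * _); rewrite coef_poly lt_j; apply/esym/ps_mulE; rewrite -ltnS.
Qed.

Lemma ps_mul1 f : ps_mul f ps_one =1 f.
Proof.
move=> n; rewrite /ps_mul big_ord_recr /= subnn mulr1 big1 ?add0r // => i _.
by rewrite /ps_one subn_eq0 leqNgt ltn_ord mulr0.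
Qed.

Lemma ps_1mul f : ps_mul ps_one f =1 f.
Proof.
move=> n; rewrite /ps_mul big_ord_recl /= subn0 mul1r big1 ?addr0 // => i _.
by rewrite mul0r.
Qed.

Lemma ps_recP (F : nat -> seq A -> A) :
  exists g, forall n, g n = F n (mkseq g n).
Proof.
pose s n := iteri n (fun n s => rcons s (F n s)) [::].
have szs n : size (s n) = n by elim: n => //= n IH; rewrite size_rcons IH.
pose g n := F n (s n); exists g => n; congr (F _ _).
by elim: n => //= n IH; rewrite mkseqS -IH.
Qed.

Lemma ps_inv_exists f : f 0%N = 1 ->
  exists g, ps_mul f g =1 ps_one /\ ps_mul g f =1 ps_one.
Proof.
move=> f0.
have [r rE] := ps_recP (fun n s => ps_one n - \sum_(i < n) f i.+1 * s`_(n - i.+1)).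
have [l lE] := ps_recP (fun n s => ps_one n - \sum_(i < n) s`_i * f (n - i)%N).
have fr : ps_mul f r =1 ps_one.
  move=> n; rewrite /ps_mul big_ord_recl f0 mul1r subn0 [r n]rE.
  rewrite -[RHS](subrK (\sum_(i < n) f i.+1 * (mkseq r n)`_(n - i.+1))).
  congr (_ + _); apply: eq_bigr => i _; rewrite nth_mkseq //.
  by rewrite ltn_subrL (leq_trans _ (ltn_ord i)).
have lf : ps_mul l f =1 ps_one.
  move=> n; rewrite /ps_mul big_ord_recr /= subnn f0 mulr1 [l n]lE addrC.
  rewrite -[RHS](subrK (\sum_(i < n) (mkseq l n)`_i * f (n - i)%N)).
  by congr (_ + _); apply: eq_bigr => i _; rewrite nth_mkseq.
have lr : l =1 r.
  move=> n; rewrite -(ps_mul1 l) -(ps_1mul r) -(eq_ps_mul (frefl l) fr).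
  by rewrite ps_mulA (eq_ps_mul lf (frefl r)).
by exists r; split=> // n; rewrite -(eq_ps_mul lr (frefl f)).
Qed.

End PowerSeries.

(* lambda(-t) sigma(t) = sigma(t) lambda(-t) = 1 *)
Definition is_S (K : comNzRingType) (S : nat -> NSym K) : Prop :=
  ps_mul (ps_alt (Lambda K)) S =1 @ps_one (NSym K) /\
  ps_mul S (ps_alt (Lambda K)) =1 @ps_one (NSym K).

(* d sigma(t) / dt = xi(t) sigma(t) *)
Definition is_Xi (K : comNzRingType) (S Xi : nat -> NSym K) : Prop :=
  ps_deriv S =1 ps_mul (ps_shift Xi) S.

Lemma S_exists (K : comNzRingType) : exists S : nat -> NSym K, is_S S.
Proof. by apply: ps_inv_exists; rewrite /ps_alt mulr1. Qed.

Lemma S_unique (K : comNzRingType) (S S' : nat -> NSym K) :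
  is_S S -> is_S S' -> S =1 S'.
Proof.
move=> [_ SL] [LS' _] n; rewrite -(ps_mul1 S) -(ps_1mul S').
by rewrite -(eq_ps_mul (frefl S) LS') ps_mulA (eq_ps_mul SL (frefl S')).
Qed.

Lemma Xi_exists (K : comNzRingType) (S : nat -> NSym K) :
  is_S S -> exists Xi : nat -> NSym K, is_Xi S Xi.
Proof.
move=> [LS _].
exists (fun m => ps_mul (ps_deriv S) (ps_alt (Lambda K)) m.-1) => n.
rewrite /ps_shift /= -[LHS]ps_mul1 -(eq_ps_mul (frefl _) LS) ps_mulA.
exact: eq_ps_mul.
Qed.

Lemma Xi_unique (K : comNzRingType) (S Xi Xi' : nat -> NSym K) :
  is_S S -> is_Xi S Xi -> is_Xi S Xi' -> forall m, (0 < m)%N -> Xi m = Xi' m.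
Proof.
move=> [_ SL] X X' [//|m] _.
suff /(_ m) : ps_shift Xi =1 ps_shift Xi' by [].
move=> n; rewrite -[LHS]ps_mul1 -[RHS]ps_mul1.
rewrite -!(eq_ps_mul (frefl _) SL) !ps_mulA.
by apply: eq_ps_mul => // k; rewrite -X -X'.
Qed.

Definition is_composition (I : seq nat) : bool :=
  (I != [::]) && all (leq 1) I.

(* w^I, with the factors in the order of I *)
Definition wpow (A : nzRingType) (w : nat -> A) (I : seq nat) : A :=
  \prod_(i <- I) w i.

(* The sequences of positive integers of sum n: those starting with 1, then
   those starting with a larger integer. *)
Fixpoint compositions (n : nat) : seq (seq nat) :=
  if n is n'.+1 then
    [seq 1%N :: J | J <- compositions n'] ++
    [seq (head 0%N J).+1 :: behead J | J <- compositions n' & J != [::]]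
  else [:: [::]].

Lemma mem_compositions n J :
  (J \in compositions n) = all (leq 1) J && (sumn J == n).
Proof.
elim: n J => [|n IHn] J.
  by rewrite inE; case: J => [|[|j] J] //=; rewrite andbF.
rewrite /= mem_cat; apply/orP/andP => [[] /mapP[J'] |].
- by rewrite IHn => /andP[J'P /eqP <-] ->.
- rewrite mem_filter IHn; case: J' => //= j J' /andP[/andP[_ J'P] /eqP <-] ->.
  by rewrite /= J'P.
case: J => [|[|[|j]] J] /=; [by case | by case | |];
  rewrite add1n || rewrite addSn; rewrite eqSS => -[JP /eqP sJ].
- by left; apply/mapP; exists J; rewrite // IHn JP -sJ eqxx.
- right; apply/mapP; exists (j.+1 :: J); rewrite // mem_filter IHn.
  by rewrite /= JP -sJ eqxx.
Qed.

Lemma compositions_uniq n : uniq (compositions n).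
Proof.
elim: n => //= n IHn; rewrite cat_uniq map_inj_uniq ?IHn => [|J J' [] //] /=.
apply/andP; split.
  apply/hasPn => J /mapP[[|j J']]; rewrite mem_filter // mem_compositions /=.
  by case: j => // j _ ->; apply/mapP => -[].
rewrite map_inj_in_uniq ?filter_uniq // => -[|j J] [|k J'] //;
  by rewrite !mem_filter //= => _ _ [-> ->].
Qed.

(* The blocks J_1, ..., J_m of J over I: cut off the shortest prefix of J whose
   sum reaches i_1, and go on with the rest of J and of I. *)
Fixpoint blocks (J I : seq nat) : seq (seq nat) :=
  if I is i :: I' then
    let k := find (fun k => i <= sumn (take k J))%N (iota 0 (size J).+1) in
    take k J :: blocks (drop k J) I'
  else [::].

Definition refines (J I : seq nat) : bool :=
  let Js := blocks J I in
  [&& all is_composition Js, flatten Js == J & map sumn Js == I].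

Lemma blocksE (Js : seq (seq nat)) :
  all is_composition Js -> blocks (flatten Js) (map sumn Js) = Js.
Proof.
elim: Js => // J Js IH /andP[/andP[_ Jpos] /IH{}IH].
rewrite [flatten _]/= [map _ _]/= /blocks -/blocks; cbv zeta; set k := find _ _.
suff -> : k = size J by rewrite take_size_cat // drop_size_cat // IH.
rewrite {}/k; set L := J ++ flatten Js.
have szL : (size J <= size L)%N by rewrite size_cat leq_addr.
have -> : iota 0 (size L).+1 =
  iota 0 (size J) ++ size J :: iota (size J).+1 (size L - size J).
  by rewrite -{1}(subnKC szL) -addnS iotaD add0n.
rewrite find_cat size_iota ifN /=.
  by rewrite take_size_cat // leqnn addn0.
apply/hasPn => k; rewrite mem_iota add0n /= => lt_kJ.
rewrite take_cat lt_kJ -ltnNge -{2}(cat_take_drop k J) sumn_cat.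
rewrite -{1}[sumn _]addn0 ltn_add2l (drop_nth 0%N lt_kJ) /=.
by rewrite ltn_addr // (all_nthP 0%N Jpos).
Qed.

Lemma refinesP J I :
  reflect (exists Js : seq (seq nat),
             [/\ all is_composition Js, flatten Js = J & map sumn Js = I])
          (refines J I).
Proof.
apply: (iffP and3P) => [[Jc /eqP JE /eqP IE] | [Js [Jc <- <-]]].
  by exists (blocks J I).
by rewrite blocksE.
Qed.

Definition fp (I : seq nat) : nat := head 0%N I.

Definition pi_u (I : seq nat) : nat :=
  (\prod_(1 <= j < (size I).+1) sumn (take j I))%N.

Definition fp2 (J I : seq nat) : nat := (\prod_(B <- blocks J I) fp B)%N.

Definition pi_u2 (J I : seq nat) : nat := (\prod_(B <- blocks J I) pi_u B)%N.

(* Main.v *)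
Require Import Defs.
From mathcomp Require Import all_boot all_order ssralg ssrnum ssrint rat.
From mathcomp.multinomials Require Import monalg.

Import GRing.Theory.
Local Open Scope ring_scope.

(** The defining relation of [Xi], read at the coefficient of t^n, is
      (n+1) S_(n+1) = Xi_1 S_n + Xi_2 S_(n-1) + ... + Xi_(n+1) S_0.
    It is a recursion for both families, and each formula for a one-part
    composition is this recursion unfolded.

    Dividing by n+1 and expanding S_(n-i) inductively, a composition J of n+1
    is built by adding its first part last; the factor 1/(n+1) it then gains
    is the inverse of its full sum.  So the coefficient of Xi^J is the inverse
    of the product of the sums of the suffixes of J, which is pi_u of the
    reversal of J ([S_expansion]).

    Since S_0 = 1, solving instead for Xi_(n+1) builds J by adding its last
    part; every part added to a nonempty J changes the sign and leaves the
    first part alone, whereas the one-part composition comes from the term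
    (n+1) S_(n+1).  So the coefficient of S^J is (-1)^(l(J)-1) fp(J)
    ([Xi_expansion]).

    For a general composition I, multiply the expansions of the parts of I:
    choosing a composition of each part amounts to choosing a refinement of I,
    whose blocks are the compositions chosen ([sum_refinements]). Coefficients
    that are products over the blocks are thus those of the product. *)

(** * Scalars in monoid algebras *)

(** Scalars commute with one another and with the monoid elements, so they can
    be collected in front of a product; the lemmas below ask for this property
    of the algebra they are stated for. *)
Lemma malg_scale_central (M : monomType) (K : comNzRingType) (c : K)
    (x y : {malg K[M]}) : c *: (x * y) = x * (c *: y).
Proof.
rewrite (malgMEw (finmap.fsubset_refl _) (msuppZ_le c y)) malgME scaler_sumr.
apply: eq_bigr => k1 _; rewrite scaler_sumr; apply: eq_bigr => k2 _.
apply/malgP => k; rewrite mcoeffZ [in RHS]mcoeffU mcoeffZ.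
by rewrite [in LHS]mcoeffU mulrnAr mulrCA.
Qed.

(** * Sums over compositions *)

Section CompositionSums.
Variable V : nmodType.
Implicit Type F : seq nat -> V.

Lemma sum_compositions0 F : \sum_(J <- compositions 0) F J = F [::].
Proof. by rewrite big_seq1. Qed.

Lemma sum_compositions_cons n F :
  \sum_(J <- compositions n.+1) F J =
  \sum_(j < n.+1) \sum_(J <- compositions (n - j)) F (j.+1 :: J).
Proof.
elim: n F => [|n IHn] F.
  by rewrite big_ord1 subnn !big_seq1.
rewrite [compositions n.+2]/= big_cat !big_map big_ord_recl subn0; congr (_ + _).
(* The compositions of n+2 whose first part exceeds 1 are those of n+1 with the
   first part incremented, and the latter are all nonempty. *)
rewrite big_filter big_seq_cond.
under eq_bigl => J.
  have -> : (J \in compositions n.+1) && (J != [::]) = (J \in compositions n.+1).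
    by rewrite mem_compositions; case: J => //= *; rewrite andbT.
  over.
by rewrite -big_seq IHn.
Qed.

Lemma perm_rev_compositions n :
  perm_eq [seq rev J | J <- compositions n] (compositions n).
Proof.
apply: uniq_perm; rewrite ?map_inj_uniq ?compositions_uniq //.
  exact/inv_inj/revK.
move=> J; rewrite -{1}[J]revK mem_map; last exact/inv_inj/revK.
by rewrite !mem_compositions all_rev sumn_rev.
Qed.

Lemma sum_compositions_rcons n F :
  \sum_(J <- compositions n.+1) F J =
  \sum_(j < n.+1) \sum_(J <- compositions (n - j)) F (rcons J j.+1).
Proof.
rewrite -(perm_big _ (perm_rev_compositions _)) big_map sum_compositions_cons.
apply: eq_bigr => j _; rewrite -[RHS](perm_big _ (perm_rev_compositions _)) big_map.
by apply: eq_bigr => J _; rewrite rev_cons.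
Qed.

End CompositionSums.

(** * Blocks of a refinement *)

Lemma is_composition_mem n B :
  (0 < n)%N -> (B \in compositions n) = is_composition B && (sumn B == n).
Proof.
move=> n_gt0; rewrite mem_compositions /is_composition.
by case: B => //=; rewrite eq_sym eqn0Ngt n_gt0.
Qed.

Lemma refines_sumn {J I} : refines J I -> all (leq 1) J /\ sumn J = sumn I.
Proof.
case/refinesP => Js [Jc <- <-]; elim: Js Jc => //= B Js IH /andP[/andP[_ Bp] /IH].
by rewrite all_cat sumn_cat Bp => -[-> ->].
Qed.

Lemma blocks_cat {B J I} :
  is_composition B -> refines J I -> blocks (B ++ J) (sumn B :: I) = B :: blocks J I.
Proof.
move=> Bc /refinesP[Js [Jc <- <-]].
by rewrite [RHS](congr1 _ (blocksE Jc)) -(@blocksE (B :: Js)) //= Bc.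
Qed.

Lemma refines_rev J I :
  refines J I -> blocks (rev J) (rev I) = rev [seq rev B | B <- blocks J I].
Proof.
(* Reversing a concatenation reverses both the list of blocks and each block. *)
case/refinesP => Js [Jc <- <-]; rewrite blocksE //.
rewrite rev_flatten -map_rev.
have -> : rev [seq sumn B | B <- Js] = [seq sumn B | B <- rev [seq rev B | B <- Js]].
  by rewrite map_rev -map_comp; congr rev; apply: eq_map => B /=; rewrite sumn_rev.
rewrite map_rev blocksE // all_rev all_map; apply: sub_all Jc => B /=.
rewrite /is_composition all_rev; case: B => //= b B.
by rewrite rev_cons; case: (rev B).
Qed.

(** The first block of a refinement of [i :: I] is a composition of [i], and
    what follows it is a refinement of [I]. *)
Lemma perm_refinements_cons i I : (0 < i)%N ->
  perm_eq [seq J <- compositions (i + sumn I) | refines J (i :: I)]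
    [seq B ++ J | B <- compositions i,
                  J <- [seq J <- compositions (sumn I) | refines J I]].
Proof.
move=> i_gt0; apply: uniq_perm.
- exact/filter_uniq/compositions_uniq.
- apply: allpairs_uniq; rewrite ?filter_uniq ?compositions_uniq //.
  move=> p q /allpairsP[[B J] [/= BP]]; rewrite mem_filter => /andP[JI _] -> {p}.
  move=> /allpairsP[[C L] [/= CP]]; rewrite mem_filter => /andP[LI _] -> {q} /= E.
  move: BP CP; rewrite !is_composition_mem // => /andP[Bc /eqP sB] /andP[Cc /eqP sC].
  have := blocks_cat Bc JI; rewrite {}E sB -sC (blocks_cat Cc LI) => -[<- E].
  by case/and3P: JI => _ /eqP <- _; case/and3P: LI => _ /eqP <- _; rewrite E.
move=> J; rewrite mem_filter; apply/andP/allpairsP => [[] | [[B L] [/=]]].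
  case/refinesP=> -[|B Js] [Jc <- // [<- <-]] _; case/andP: Jc => Bc Jc.
  exists (B, flatten Js); split=> //=.
    by rewrite mem_compositions eqxx andbT; case/andP: Bc.
  have ref : refines (flatten Js) [seq sumn B | B <- Js].
    by apply/refinesP; exists Js.
  have [Lp Ls] := refines_sumn ref.
  by rewrite mem_filter mem_compositions ref Lp Ls /=.
rewrite is_composition_mem // mem_filter => /andP[Bc /eqP <-] /andP[LI _] ->.
have ref : refines (B ++ L) (sumn B :: I).
  case/refinesP: LI => Js [Jc <- <-]; apply/refinesP; exists (B :: Js).
  by rewrite /= Bc.
by have [Lp Ls] := refines_sumn ref; rewrite ref mem_compositions Lp Ls /=.
Qed.

(** A refinement of [I] is a choice of one composition for each part of [I], which
    is what a term of the expanded product on the right chooses; [c] weighs the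
    blocks independently. *)
Lemma sum_refinements (K : comNzRingType) (A : lalgType K)
    (scale_central : forall (a : K) (x y : A), a *: (x * y) = x * (a *: y))
    (w : nat -> A) (c : seq nat -> K) (I : seq nat) : all (leq 1) I ->
  \sum_(J <- compositions (sumn I) | refines J I)
     (\prod_(B <- blocks J I) c B) *: wpow w J =
  \prod_(i <- I) \sum_(B <- compositions i) c B *: wpow w B.
Proof.
elim: I => [_|i I IH /andP[i_gt0 /IH{}IH]].
  by rewrite /= big_cons /= !big_nil addr0 scale1r /wpow big_nil.
rewrite big_cons -{}IH -big_filter (perm_big _ (perm_refinements_cons _ I i_gt0)).
rewrite big_allpairs_dep mulr_suml; apply: eq_big_seq => B.
rewrite is_composition_mem // => /andP[Bc /eqP <-].
rewrite big_filter mulr_sumr; apply: eq_bigr => J JI.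
by rewrite blocks_cat // big_cons /wpow big_cat /= -scalerAl -scale_central scalerA.
Qed.

Lemma pi_u_rcons B a : pi_u (rcons B a) = (pi_u B * (sumn B + a))%N.
Proof.
rewrite /pi_u size_rcons big_nat_recr //= -sumn_rcons take_oversize ?size_rcons //.
congr (_ * _)%N; apply: eq_big_nat => j /andP[_ lt_j].
by rewrite -cats1 takel_cat.
Qed.

(** * Expansions of single generators *)

Section Expansions.
Variables (K : comNzRingType) (A : lalgType K) (S Xi : nat -> A).
Hypothesis S0 : S 0%N = 1.
Hypothesis S_deriv : ps_deriv S =1 ps_mul (ps_shift Xi) S.

(** [inv n] stands for 1/n in [K]; it is multiplicative because the inverse of
    pi_u is built up one suffix sum at a time. *)
Lemma S_expansion
    (scale_central : forall (a : K) (x y : A), a *: (x * y) = x * (a *: y))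
    (inv : nat -> K) (inv1 : inv 1%N = 1)
    (invM : {morph inv : m n / (m * n)%N >-> m * n})
    (invK : forall n, inv n.+1 * n.+1%:R = 1) n :
  S n = \sum_(J <- compositions n) inv (pi_u (rev J)) *: wpow Xi J.
Proof.
elim/ltn_ind: n => -[|n] IH.
  by rewrite sum_compositions0 /pi_u big_nil inv1 scale1r /wpow big_nil.
rewrite sum_compositions_cons -[LHS]scale1r -(invK n) -scalerA scaler_nat.
rewrite [X in _ *: X](S_deriv n) scaler_sumr; apply: eq_bigr => i _.
have le_i : (i <= n)%N by rewrite -ltnS.
rewrite IH ?ltnS ?leq_subr // mulr_sumr scaler_sumr; apply: eq_big_seq => J.
rewrite mem_compositions => /andP[_ /eqP sJ].
rewrite rev_cons pi_u_rcons sumn_rev sJ addnS subnK // invM /wpow big_cons.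
by rewrite -scale_central scalerA mulrC.
Qed.

Lemma Xi_expansion n :
  Xi n.+1 = \sum_(J <- compositions n.+1) - ((-1) ^+ size J * (fp J)%:R) *: wpow S J.
Proof.
elim/ltn_ind: n => n IH.
have := S_deriv n; rewrite /ps_deriv /ps_mul big_ord_recr /= subnn S0 mulr1.
move/esym/(canRL (addKr _)); rewrite /ps_shift => ->.
rewrite sum_compositions_rcons big_ord_recr /= subnn sum_compositions0.
(* j = n is the one-part composition; reversing the range of j < n matches the
   last part j+1 with the factor S_(j+1). *)
rewrite /wpow /= big_seq1 expr1 mulN1r opprK scaler_nat; congr (_ + _).
rewrite -sumrN (reindex_inj rev_ord_inj) /=; apply: eq_bigr => j _.
have lt_j := ltn_ord j; rewrite IH ?ltn_subrL ?(leq_trans _ lt_j) //.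
rewrite subKn // subnSK // mulr_suml -sumrN; apply: eq_big_seq => J.
rewrite is_composition_mem ?subn_gt0 // => /andP[/andP[J0 _] _].
rewrite size_rcons exprS mulN1r mulNr opprK -cats1 big_cat /= big_seq1.
by rewrite -scalerAl scaleNr opprK; case: J J0.
Qed.

End Expansions.

Theorem mainTheorem11 (K : comAlgType rat) (S Xi : nat -> NSym K)
    (hS : is_S S) (hXi : is_Xi S Xi) (I : seq nat) (hI : is_composition I) :
  wpow S I =
    \sum_(J <- compositions (sumn I) | refines J I)
       ((pi_u2 (rev J) (rev I))%:R^-1 : rat)%:A *: wpow Xi J
  /\
  wpow Xi I =
    (-1) ^+ size I *:
      \sum_(J <- compositions (sumn I) | refines J I)
         ((-1) ^+ size J * (fp2 J I)%:R) *: wpow S J.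
Proof.
have S0 : S 0%N = 1.
  by have := hS.1 0%N; rewrite /ps_mul big_ord1 /ps_alt /= mul1r mul1r.
have /andP[_ Ipos] := hI.
have central := @malg_scale_central {fmonom nat} K.
pose inv n : K := (n%:R^-1 : rat)%:A.
have inv1 : inv 1%N = 1 by rewrite /inv invr1 scale1r.
have invM : {morph inv : m n / (m * n)%N >-> m * n}.
  by move=> m n; rewrite /inv natrM invfM -scalerAl mul1r scalerA.
have invK n : inv n.+1 * n.+1%:R = 1.
  rewrite /inv -scalerAl mul1r -(scaler_nat _ (1 : K)) scalerA mulVf ?scale1r //.
  by rewrite Num.Theory.pnatr_eq0.
split.
  transitivity
    (\prod_(i <- I) \sum_(B <- compositions i) inv (pi_u (rev B)) *: wpow Xi B).
    by apply: eq_bigr => i _; apply: (S_expansion K _ S Xi S0 hXi central).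
  rewrite -(sum_refinements _ _ central) //.
  apply: eq_bigr => J JI; congr (_ *: _).
  rewrite /pi_u2 refines_rev // (perm_big _ (permEl (perm_rev _))) big_map.
  by rewrite -/(inv _) (big_morph inv invM inv1).
(* One sign -1 per block makes up the global sign (-1)^l(I). *)
pose c B : K := - ((-1) ^+ size B * (fp B)%:R).
transitivity (\prod_(i <- I) \sum_(B <- compositions i) c B *: wpow S B).
  apply: eq_big_seq => -[|i] /(allP Ipos) // _.
  exact: (Xi_expansion K _ S Xi S0 hXi).
rewrite -(sum_refinements _ _ central) // scaler_sumr.
apply: eq_bigr => J JI; rewrite scalerA; congr (_ *: _); rewrite /c /fp2.
case/refinesP: JI => Js [Jc <- <-]; rewrite blocksE // size_map.
elim: Js {Jc} => [|B Js IH] /=; first by rewrite !big_nil !mulr1.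
rewrite !big_cons {}IH size_cat exprS exprD natrM mulN1r !mulNr; congr (- _).
by rewrite [in RHS]mulrACA mulrCA [LHS]mulrCA; congr (_ * _); exact: mulrCA.
Qed.
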